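(* Let $\mathbf{A}$ be an abelian category and $\varepsilon\geq 0$. Then the category $\mathbf{Int}_\varepsilon(\mathbf{A})$ of $\varepsilon$-interleavings in $\mathbf{A}$ is an abelian category.
   Context: $(\mathbb{R},\leq)$ denotes the poset of real numbers viewed as a category. $T_\varepsilon:(\mathbb{R},\leq)\to(\mathbb{R},\leq)$ is the functor $T_\varepsilon(x)=x+\varepsilon$. The objects of $\mathbf{Int}_\varepsilon(\mathbf{A})$ are $\varepsilon$-interleavings $(F,G,\varphi,\psi)$, where $F,G:(\mathbb{R},\leq)\to\mathbf{A}$ are functors and $\varphi:F\Rightarrow GT_\varepsilon$, $\psi:G\Rightarrow FT_\varepsilon$ are natural transformations such that for all $a\in\mathbb{R}$, $\psi(a+\varepsilon)\varphi(a)=F(a\leq a+2\varepsilon)$ and $\varphi(a+\varepsilon)\psi(a)=G(a\leq a+2\varepsilon)$. A morphism $(\alpha,\beta):(F,G,\varphi,\psi)\to(F',G',\varphi',\psi')$ is a pair of natural transformations $\alpha:F\Rightarrow F'$, $\beta:G\Rightarrow G'$ such that $(\beta T_\varepsilon)\varphi=\varphi'\alpha$ and $(\alpha T_\varepsilon)\psi=\psi'\beta$. Composition is componentwise. A category is abelian if it has a zero object and all finite products and coproducts, every morphism has a kernel and a cokernel, every monomorphism is a kernel, and every epimorphism is a cokernel. *)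

(* Defs.v *)
From mathcomp Require Import all_boot all_order all_algebra.
From mathcomp Require Import boolp reals.

Set Implicit Arguments.
Unset Strict Implicit.
Unset Printing Implicit Defensive.

Import Order.TTheory GRing.Theory Num.Theory.

Declare Scope cat_scope.
Delimit Scope cat_scope with cat.
Local Open Scope cat_scope.

Record category := Category {
  obj :> Type;
  hom : obj -> obj -> Type;
  idm : forall X, hom X X;
  comp : forall X Y Z, hom Y Z -> hom X Y -> hom X Z;
  comp_idl : forall X Y (f : hom X Y), comp (idm Y) f = f;
  comp_idr : forall X Y (f : hom X Y), comp f (idm X) = f;
  compA : forall X Y Z W (h : hom Z W) (g : hom Y Z) (f : hom X Y),
    comp h (comp g f) = comp (comp h g) f
}.
Arguments hom {c} X Y.
Arguments idm {c} X.
Arguments comp {c X Y Z} g f.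
Notation "g ∘ f" := (comp g f) (at level 40, left associativity) : cat_scope.

Section Abelian.
Variable C : category.

Definition is_mono (X Y : C) (f : hom X Y) : Prop :=
  forall (W : C) (g h : hom W X), f ∘ g = f ∘ h -> g = h.

Definition is_epi (X Y : C) (f : hom X Y) : Prop :=
  forall (W : C) (g h : hom Y W), g ∘ f = h ∘ f -> g = h.

Definition is_zero_object (Z : C) : Prop :=
  forall X : C, (exists! f : hom X Z, True) /\ (exists! f : hom Z X, True).

Definition is_zero_morphism (X Y : C) (f : hom X Y) : Prop :=
  exists Z : C, is_zero_object Z /\
    exists (g : hom X Z) (h : hom Z Y), f = h ∘ g.

Definition is_product (I : Type) (X : I -> C) (P : C)
    (pr : forall i, hom P (X i)) : Prop :=
  forall (W : C) (f : forall i, hom W (X i)),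
    exists! u : hom W P, forall i, pr i ∘ u = f i.

Definition is_coproduct (I : Type) (X : I -> C) (S : C)
    (inj : forall i, hom (X i) S) : Prop :=
  forall (W : C) (f : forall i, hom (X i) W),
    exists! u : hom S W, forall i, u ∘ inj i = f i.

(* [is_kernel f k]: [k] is a kernel of [f]. *)
Definition is_kernel (X Y : C) (f : hom X Y) (K : C) (k : hom K X) : Prop :=
  is_zero_morphism (f ∘ k) /\
  forall (W : C) (g : hom W X), is_zero_morphism (f ∘ g) ->
    exists! u : hom W K, k ∘ u = g.

(* [is_cokernel f q]: [q] is a cokernel of [f]. *)
Definition is_cokernel (X Y : C) (f : hom X Y) (Q : C) (q : hom Y Q) : Prop :=
  is_zero_morphism (q ∘ f) /\
  forall (W : C) (g : hom Y W), is_zero_morphism (g ∘ f) ->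
    exists! u : hom Q W, u ∘ q = g.

Record is_abelian : Prop := IsAbelian {
  has_zero_object : exists Z : C, is_zero_object Z;
  has_finite_products : forall (n : nat) (X : 'I_n -> C),
    exists (P : C) (pr : forall i, hom P (X i)), is_product pr;
  has_finite_coproducts : forall (n : nat) (X : 'I_n -> C),
    exists (S : C) (inj : forall i, hom (X i) S), is_coproduct inj;
  has_kernels : forall (X Y : C) (f : hom X Y),
    exists (K : C) (k : hom K X), is_kernel f k;
  has_cokernels : forall (X Y : C) (f : hom X Y),
    exists (Q : C) (q : hom Y Q), is_cokernel f q;
  mono_is_kernel : forall (X Y : C) (f : hom X Y), is_mono f ->
    exists (Z : C) (g : hom Y Z), is_kernel g f;
  epi_is_cokernel : forall (X Y : C) (f : hom X Y), is_epi f ->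
    exists (Z : C) (g : hom Z X), is_cokernel g f
}.

End Abelian.

Record functor (C D : category) := Functor {
  fobj :> C -> D;
  fmap : forall X Y, hom X Y -> hom (fobj X) (fobj Y);
  fmap_id : forall X, fmap (idm X) = idm (fobj X);
  fmap_comp : forall X Y Z (g : hom Y Z) (f : hom X Y),
    fmap (g ∘ f) = fmap g ∘ fmap f
}.
Arguments fmap {C D} F {X Y} f : rename.

Definition functor_comp (C D E : category) (G : functor D E) (F : functor C D) :
  functor C E.
Proof.
refine (@Functor C E (fun X => G (F X)) (fun X Y f => fmap G (fmap F f)) _ _).
- by move=> X; rewrite !fmap_id.
- by move=> X Y Z g f; rewrite !fmap_comp.
Defined.

Record nat_trans (C D : category) (F G : functor C D) := NatTrans {
  component :> forall X : C, hom (F X) (G X);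
  naturality : forall (X Y : C) (f : hom X Y),
    component Y ∘ fmap F f = fmap G f ∘ component X
}.

Lemma nat_trans_eq (C D : category) (F G : functor C D) (s t : nat_trans F G) :
  (forall X, s X = t X) -> s = t.
Proof.
case: s t => [s sP] [t tP] /= st.
have est : s = t by exact: functional_extensionality_dep.
by subst t; congr NatTrans; exact: Prop_irrelevance.
Qed.

Definition nat_id (C D : category) (F : functor C D) : nat_trans F F.
Proof.
refine (@NatTrans C D F F (fun X => idm (F X)) _).
by move=> X Y f; rewrite comp_idl comp_idr.
Defined.

Definition nat_comp (C D : category) (F G H : functor C D)
  (t : nat_trans G H) (s : nat_trans F G) : nat_trans F H.
Proof.
refine (@NatTrans C D F H (fun X => t X ∘ s X) _).
by move=> X Y f; rewrite -compA naturality compA naturality compA.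
Defined.

Definition whisker (B C D : category) (F G : functor C D) (s : nat_trans F G)
  (T : functor B C) : nat_trans (functor_comp F T) (functor_comp G T).
Proof.
refine (@NatTrans B D (functor_comp F T) (functor_comp G T) (fun X => s (T X)) _).
by move=> X Y f; exact: (naturality s (fmap T f)).
Defined.

Local Open Scope ring_scope.

(* The poset (R, <=) as a category: the hom-type from x to y is the
   proposition x <= y, so it has at most one element. *)
Definition real_cat (R : realType) : category.
Proof.
refine (@Category R (fun x y => x <= y) (fun x => lexx x)
  (fun x y z hyz hxy => le_trans hxy hyz) _ _ _);
by move=> *; exact: bool_irrelevance.
Defined.

Definition shift (R : realType) (e : R) : functor (real_cat R) (real_cat R).
Proof.
refine (@Functor (real_cat R) (real_cat R) (fun x => x + e)
  (fun x y (hxy : x <= y) => lerD hxy (lexx e)) _ _);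
by move=> *; exact: bool_irrelevance.
Defined.

Lemma le_shift2 (R : realType) (e : R) (he : 0 <= e) (a : R) : a <= a + e + e.
Proof. by rewrite -addrA lerDl addr_ge0. Qed.

Section Interleavings.
Variables (R : realType) (e : R) (he : 0 <= e) (A : category).

Local Notation T := (shift e).

(* The object a + 2e is written a + e + e, the form in which it arises as
   T (T a), so that both sides of each identity live in the same hom-type. *)
Record interleaving := Interleaving {
  ilF : functor (real_cat R) A;
  ilG : functor (real_cat R) A;
  ilphi : nat_trans ilF (functor_comp ilG T);
  ilpsi : nat_trans ilG (functor_comp ilF T);
  il_psiphi : forall a : R,
    ilpsi (a + e) ∘ ilphi a = fmap ilF (le_shift2 he a : @hom (real_cat R) _ _);
  il_phipsi : forall a : R,
    ilphi (a + e) ∘ ilpsi a = fmap ilG (le_shift2 he a : @hom (real_cat R) _ _)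
}.

Record interleaving_hom (I J : interleaving) := InterleavingHom {
  ilalpha : nat_trans (ilF I) (ilF J);
  ilbeta : nat_trans (ilG I) (ilG J);
  ilhom_phi :
    nat_comp (whisker ilbeta T) (ilphi I) = nat_comp (ilphi J) ilalpha;
  ilhom_psi :
    nat_comp (whisker ilalpha T) (ilpsi I) = nat_comp (ilpsi J) ilbeta
}.

Lemma interleaving_hom_eq (I J : interleaving) (s t : interleaving_hom I J) :
  (forall a, ilalpha s a = ilalpha t a) ->
  (forall a, ilbeta s a = ilbeta t a) -> s = t.
Proof.
case: s t => [a b p q] [a' b' p' q'] /= ea eb.
have eaa : a = a' by exact: nat_trans_eq.
have ebb : b = b' by exact: nat_trans_eq.
by subst a' b'; congr InterleavingHom; exact: Prop_irrelevance.
Qed.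

Definition interleaving_id (I : interleaving) : interleaving_hom I I.
Proof.
refine (@InterleavingHom I I (nat_id _) (nat_id _) _ _);
by apply: nat_trans_eq => a /=; rewrite comp_idl comp_idr.
Defined.

Definition interleaving_comp (I J K : interleaving)
  (t : interleaving_hom J K) (s : interleaving_hom I J) : interleaving_hom I K.
Proof.
refine (@InterleavingHom I K (nat_comp (ilalpha t) (ilalpha s))
  (nat_comp (ilbeta t) (ilbeta s)) _ _); apply: nat_trans_eq => a /=.
- have /(congr1 (fun u => component u a)) /= hs := ilhom_phi s.
  have /(congr1 (fun u => component u a)) /= ht := ilhom_phi t.
  by rewrite -compA hs compA ht compA.
- have /(congr1 (fun u => component u a)) /= hs := ilhom_psi s.
  have /(congr1 (fun u => component u a)) /= ht := ilhom_psi t.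
  by rewrite -compA hs compA ht compA.
Defined.

Definition Int : category.
Proof.
refine (@Category interleaving interleaving_hom interleaving_id
  interleaving_comp _ _ _).
- by move=> I J s; apply: interleaving_hom_eq => a /=; rewrite comp_idl.
- by move=> I J s; apply: interleaving_hom_eq => a /=; rewrite comp_idr.
- by move=> I J K L u t s; apply: interleaving_hom_eq => a /=; rewrite compA.
Defined.

End Interleavings.

(* Main.v *)
From Pilot Require Import Defs.
From mathcomp Require Import all_boot all_order all_algebra.
From mathcomp Require Import boolp reals.
Import Pilot.Defs.

Import Order.TTheory GRing.Theory Num.Theory.
Local Open Scope ring_scope.
Local Open Scope cat_scope.

Set Implicit Arguments.
Unset Strict Implicit.

(** An [e]-interleaving is the same thing as a diagram in [A] indexed by two
    copies of the real line, with [x] in one copy below [y] in the other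
    exactly when [x + e <= y]. The values on the copies are the functors [F]
    and [G], the arrows between the copies are [phi] and [psi], and the two
    interleaving identities say that going to the other copy and back is the
    internal map of the diagram: this is what makes the assignment functorial
    ([diagram_map_comp]). The category of interleavings is therefore equivalent
    to a functor category ([diagram_functor_equivalence]), being abelian is
    invariant under equivalence ([abelian_equiv]), and functors into an abelian
    category form an abelian category ([fun_abelian]).

    Since being abelian is self-dual, only half of it has to be studied: a zero
    object, finite products, kernels and normality of monomorphisms
    ([is_half_abelian]). The other half is the same statement about the opposite
    category, and the opposite of a functor category is equivalent to the
    functor category of the opposites ([op_fun_cat_equivalence]).

    In a functor category, limits are computed pointwise. The delicate point is
    normality: a monomorphism [f] of functors must be shown to be pointwise
    monic. Triviality of the pointwise kernels does not give this at once,
    because no additive structure is assumed on the hom-sets. Instead, an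
    abelian category has equalizers, hence kernel pairs ([kernel_pair]); the
    pointwise kernel pairs of [f] form a functor, whose two projections to the
    source of [f] agree because [f] is monic, and this says that each component
    of [f] is monic ([mono_pointwise]). Each component is then the kernel of its
    cokernel, and pointwise cokernels form a functor too, so that [f] is the
    kernel of a morphism of functors. *)

Lemma dependent_choice2 (D O : Type) (H : D -> O -> Type)
    (P : forall d K, H d K -> Prop) :
  (forall d, exists K (k : H d K), P d K k) ->
  exists (K : D -> O) (k : forall d, H d (K d)), forall d, P d (K d) (k d).
Proof.
move=> ex; exists (fun d => projT1 (cid (ex d))).
exists (fun d => projT1 (cid (projT2 (cid (ex d))))) => d.
exact: projT2 (cid (projT2 (cid (ex d)))).
Qed.

(** * Zero morphisms and isomorphisms *)

Section Zero.
Variable C : category.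

Lemma hom_to_zero_eq (Z X : C) (f g : hom X Z) : is_zero_object Z -> f = g.
Proof. by move=> /(_ X)[[h [_ hu]] _]; rewrite -(hu f) ?(hu g). Qed.

Lemma hom_from_zero_eq (Z X : C) (f g : hom Z X) : is_zero_object Z -> f = g.
Proof. by move=> /(_ X)[_ [h [_ hu]]]; rewrite -(hu f) ?(hu g). Qed.

Lemma zero_morphism_compl (X Y W : C) (f : hom X Y) (g : hom Y W) :
  is_zero_morphism f -> is_zero_morphism (g ∘ f).
Proof.
move=> [Z [hZ [a [b ->]]]]; exists Z; split=> //.
by exists a, (g ∘ b); rewrite compA.
Qed.

Lemma zero_morphism_compr (X Y W : C) (f : hom X Y) (g : hom W X) :
  is_zero_morphism f -> is_zero_morphism (f ∘ g).
Proof.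
move=> [Z [hZ [a [b ->]]]]; exists Z; split=> //.
by exists (a ∘ g), b; rewrite compA.
Qed.

Lemma zero_morphism_factor (X Y Z : C) (f : hom X Y) : is_zero_object Z ->
  is_zero_morphism f -> exists (g : hom X Z) (h : hom Z Y), f = h ∘ g.
Proof.
move=> hZ [Z' [hZ' [a [b ->]]]].
have [[s _] [t _]] := hZ Z'.
exists (s ∘ a), (b ∘ t).
by rewrite -compA (compA t) (hom_to_zero_eq (t ∘ s) (idm _) hZ') comp_idl.
Qed.

Lemma zero_morphism_eq (X Y : C) (f g : hom X Y) :
  is_zero_morphism f -> is_zero_morphism g -> f = g.
Proof.
move=> [Z [hZ [a [b ->]]]] /(zero_morphism_factor hZ)[a' [b' ->]].
by rewrite (hom_to_zero_eq a a' hZ) (hom_from_zero_eq b b' hZ).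
Qed.

Definition is_inverse (X Y : C) (f : hom X Y) (g : hom Y X) : Prop :=
  g ∘ f = idm X /\ f ∘ g = idm Y.

Lemma zero_object_iso (X Y : C) (f : hom X Y) (g : hom Y X) :
  is_inverse f g -> is_zero_object X -> is_zero_object Y.
Proof.
move=> [gf fg] hX W; have [[a _] [b _]] := hX W; split.
  exists (f ∘ a); split=> // c _.
  by rewrite (hom_to_zero_eq a (g ∘ c) hX) compA fg comp_idl.
exists (b ∘ g); split=> // c _.
by rewrite (hom_from_zero_eq b (c ∘ f) hX) -compA fg comp_idr.
Qed.

Lemma product_iso (I : Type) (X : I -> C) (P Q : C) (pr : forall i, hom P (X i))
    (f : hom Q P) (g : hom P Q) :
  is_inverse f g -> is_product pr -> is_product (fun i => pr i ∘ f).
Proof.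
move=> [gf fg] hP W t; have [u [hu uu]] := hP W t.
exists (g ∘ u); split=> [i|v hv].
  by rewrite -compA (compA f) fg comp_idl hu.
by rewrite (uu (f ∘ v)) ?compA ?gf ?comp_idl // => i; rewrite compA hv.
Qed.

Lemma kernel_iso (X Y K L : C) (h : hom X Y) (k : hom K X)
    (f : hom L K) (g : hom K L) :
  is_inverse f g -> is_kernel h k -> is_kernel h (k ∘ f).
Proof.
move=> [gf fg] [hk hK]; split.
  by rewrite compA; exact: zero_morphism_compr.
move=> W t /hK[u [hu uu]]; exists (g ∘ u); split=> [|v hv].
  by rewrite -compA (compA f) fg comp_idl hu.
by rewrite (uu (f ∘ v)) ?compA ?gf ?comp_idl.
Qed.

Lemma kernel_comp_iso (X Y Z K : C) (h : hom X Y) (k : hom K X)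
    (f : hom Y Z) (g : hom Z Y) :
  is_inverse f g -> is_kernel h k -> is_kernel (f ∘ h) k.
Proof.
move=> [gf fg] [hk hK]; split.
  by rewrite -compA; exact: zero_morphism_compl.
move=> W t ht; apply: hK.
rewrite -(comp_idl h) -gf -compA -compA.
by apply: zero_morphism_compl; rewrite compA.
Qed.

Lemma kernel_mono (X Y K : C) (f : hom X Y) (k : hom K X) :
  is_kernel f k -> is_mono k.
Proof.
move=> [fk hk] W g h e.
have [|u [_ uu]] := hk W (k ∘ g); first by rewrite compA; exact: zero_morphism_compr.
by rewrite -(uu g) // -(uu h).
Qed.

End Zero.

(** * Duality *)

Definition op (C : category) : category.
Proof.
refine (@Category C (fun X Y => @hom C Y X) (@idm C)
  (fun X Y Z g f => @comp C Z Y X f g) _ _ _).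
- by move=> X Y f; rewrite comp_idr.
- by move=> X Y f; rewrite comp_idl.
- by move=> X Y Z W h g f; rewrite compA.
Defined.

Section Duality.
Variable C : category.

Lemma zero_object_op (Z : C) : @is_zero_object (op C) Z = is_zero_object Z.
Proof. by apply/propext; split=> h X; have [] := h X. Qed.

Lemma zero_morphism_op (X Y : C) (f : hom X Y) :
  @is_zero_morphism (op C) Y X f = is_zero_morphism f.
Proof.
apply/propext; split=> -[Z [hZ [g [h e]]]]; exists Z.
  by rewrite zero_object_op in hZ; split=> //; exists h, g.
by rewrite zero_object_op; split=> //; exists h, g.
Qed.

(** Passing to the opposite category only permutes the data in the definition
    of a zero morphism, so kernels and cokernels are exchanged. *)
Lemma kernel_op (X Y Q : C) (f : hom X Y) (q : hom Y Q) :
  @is_kernel (op C) Y X f Q q = is_cokernel f q.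
Proof.
apply/propext; rewrite /is_kernel zero_morphism_op.
split=> -[fq hq]; split=> // W g hg; apply: hq; first by rewrite zero_morphism_op.
by rewrite zero_morphism_op in hg.
Qed.

Lemma cokernel_op (X Y K : C) (f : hom X Y) (k : hom K X) :
  @is_cokernel (op C) Y X f K k = is_kernel f k.
Proof.
apply/propext; rewrite /is_cokernel zero_morphism_op.
split=> -[fq hq]; split=> // W g hg; apply: hq; first by rewrite zero_morphism_op.
by rewrite zero_morphism_op in hg.
Qed.

End Duality.

(** The limit half of the definition of an abelian category; its colimit half
    is this notion for the opposite category. *)
Record is_half_abelian (C : category) : Prop := IsHalfAbelian {
  half_zero_object : exists Z : C, is_zero_object Z;
  half_products : forall (n : nat) (X : 'I_n -> C),
    exists (P : C) (pr : forall i, hom P (X i)), is_product pr;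
  half_kernels : forall (X Y : C) (f : hom X Y),
    exists (K : C) (k : hom K X), is_kernel f k;
  half_mono_is_kernel : forall (X Y : C) (f : hom X Y), is_mono f ->
    exists (Z : C) (g : hom Y Z), is_kernel g f
}.

Lemma abelian_half (C : category) : is_abelian C -> is_half_abelian C.
Proof. by case=> *; split. Qed.

Lemma abelian_of_halves (C : category) :
  is_half_abelian C -> is_half_abelian (op C) -> is_abelian C.
Proof.
move=> [z p k m] [z' p' k' m']; split=> //.
- move=> X Y f; have [Q [q]] := k' Y X f.
  by rewrite kernel_op => hq; exists Q, q.
- move=> X Y f hf; have [Z [g]] := m' Y X f (fun W => hf W).
  by rewrite (@kernel_op C) => hg; exists Z, g.
Qed.

Lemma abelian_op (C : category) : is_abelian C -> is_abelian (op C).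
Proof.
move=> [[Z hZ] p s k q m e]; split=> //.
- by exists Z; rewrite zero_object_op.
- move=> X Y f; have [K [i hi]] := q Y X f.
  by exists K, i; rewrite (@kernel_op C).
- move=> X Y f; have [K [i hi]] := k Y X f.
  by exists K, i; rewrite (@cokernel_op C).
- move=> X Y f hf; have [K [i hi]] := e Y X f (fun W => hf W).
  by exists K, i; rewrite (@kernel_op C).
- move=> X Y f hf; have [K [i hi]] := m Y X f (fun W => hf W).
  by exists K, i; rewrite (@cokernel_op C).
Qed.

(** * Equivalences of categories *)

Record is_equivalence (C D : category) (F : functor C D) : Prop := IsEquivalence {
  equiv_full : forall (X Y : C) (g : hom (F X) (F Y)), exists f : hom X Y, fmap F f = g;
  equiv_faithful : forall (X Y : C) (f g : hom X Y), fmap F f = fmap F g -> f = g;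
  equiv_esurj : forall Y : D, exists (X : C) (f : hom (F X) Y) (g : hom Y (F X)),
    is_inverse f g
}.

Section Equivalence.
Variables (C D : category) (F : functor C D).
Hypothesis eqF : is_equivalence F.

Lemma zero_object_reflect (Z : C) : is_zero_object (F Z) -> is_zero_object Z.
Proof.
move=> hZ X; have [[a _] [b _]] := hZ (F X); split.
  have [f _] := equiv_full eqF a; exists f; split=> // g _.
  by apply: (equiv_faithful eqF); exact: hom_to_zero_eq.
have [f _] := equiv_full eqF b; exists f; split=> // g _.
by apply: (equiv_faithful eqF); exact: hom_from_zero_eq.
Qed.

Lemma zero_object_preserve (Z : C) : is_zero_object Z -> is_zero_object (F Z).
Proof.
move=> hZ Y; have [X [f [g [gf fg]]]] := equiv_esurj eqF Y.
have [[a _] [b _]] := hZ X; split.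
  exists (fmap F a ∘ g); split=> // c _.
  have [d hd] := equiv_full eqF (c ∘ f).
  by rewrite (hom_to_zero_eq a d hZ) hd -compA fg comp_idr.
exists (f ∘ fmap F b); split=> // c _.
have [d hd] := equiv_full eqF (g ∘ c).
by rewrite (hom_from_zero_eq b d hZ) hd compA fg comp_idl.
Qed.

(** Zero morphisms enter the definition of kernels, so they have to be
    preserved as well as reflected. For reflection, essential surjectivity moves
    the zero object of the target category into the image of [F]. *)
Lemma zero_morphism_equiv (X Y : C) (f : hom X Y) :
  is_zero_morphism (fmap F f) <-> is_zero_morphism f.
Proof.
split=> [hf|[Z [hZ [a [b ->]]]]]; last first.
  exists (F Z); split; first exact: zero_object_preserve.
  by exists (fmap F a), (fmap F b); rewrite fmap_comp.
have [z [hz _]] := hf.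
have [Z [s [t [ts st]]]] := equiv_esurj eqF z.
have hZ : is_zero_object (F Z) by exact: (zero_object_iso (f := t) (g := s)).
exists Z; split; first exact: zero_object_reflect.
have [a [b e]] := zero_morphism_factor hZ hf.
have [a' ha] := equiv_full eqF a; have [b' hb] := equiv_full eqF b.
by exists a', b'; apply: (equiv_faithful eqF); rewrite fmap_comp ha hb.
Qed.

Lemma product_reflect (I : Type) (X : I -> C) (P : C) (pr : forall i, hom P (X i)) :
  is_product (fun i => fmap F (pr i)) -> is_product pr.
Proof.
move=> hP W f; have [u [hu uu]] := hP (F W) (fun i => fmap F (f i)).
have [v hv] := equiv_full eqF u; exists v; split=> [i|w hw];
  apply: (equiv_faithful eqF).
  by rewrite fmap_comp hv.
by rewrite hv; apply: uu => i; rewrite -fmap_comp hw.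
Qed.

Lemma kernel_reflect (X Y K : C) (f : hom X Y) (k : hom K X) :
  is_kernel (fmap F f) (fmap F k) -> is_kernel f k.
Proof.
move=> [fk hk]; split; first by apply/zero_morphism_equiv; rewrite fmap_comp.
move=> W g /zero_morphism_equiv; rewrite fmap_comp => /hk[u [hu uu]].
have [v hv] := equiv_full eqF u; exists v; split=> [|w hw];
  apply: (equiv_faithful eqF).
  by rewrite fmap_comp hv.
by rewrite hv; apply: uu; rewrite -fmap_comp hw.
Qed.

(** The test objects of the target category need not be in the image of [F],
    but they are isomorphic to objects that are. *)
Lemma mono_preserve (X Y : C) (f : hom X Y) : is_mono f -> is_mono (fmap F f).
Proof.
move=> hf W g h e; have [V [s [t [ts st]]]] := equiv_esurj eqF W.
have [g' hg] := equiv_full eqF (g ∘ s); have [h' hh] := equiv_full eqF (h ∘ s).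
have gh : g' = h'.
  by apply/hf/(equiv_faithful eqF); rewrite !fmap_comp hg hh !compA e.
by rewrite -(comp_idr g) -(comp_idr h) -st !compA -hg -hh gh.
Qed.

(** Each construction is carried out in [D], moved along an isomorphism to an
    object in the image of [F], lifted by fullness, and its universal property
    is reflected. *)
Lemma half_abelian_equiv : is_half_abelian D -> is_half_abelian C.
Proof.
move=> hD; split.
- have [z hz] := half_zero_object hD.
  have [Z [s [t [ts st]]]] := equiv_esurj eqF z.
  by exists Z; apply: zero_object_reflect; exact: (zero_object_iso (f := t) (g := s)).
- move=> n X; have [P [pr hP]] := half_products hD (fun i => F (X i)).
  have [Q [s [t st]]] := equiv_esurj eqF P.
  have [pr' hpr] : exists pr' : forall i, hom Q (X i),
      forall i, fmap F (pr' i) = pr i ∘ s.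
    have ex i := cid (equiv_full eqF (pr i ∘ s)).
    by exists (fun i => projT1 (ex i)) => i; exact: projT2 (ex i).
  exists Q, pr'; apply: product_reflect.
  rewrite (_ : (fun i => fmap F (pr' i)) = (fun i => pr i ∘ s)).
    exact: product_iso st hP.
  exact: functional_extensionality_dep.
- move=> X Y f; have [K [k hK]] := half_kernels hD (fmap F f).
  have [L [s [t st]]] := equiv_esurj eqF K.
  have [l hl] := equiv_full eqF (k ∘ s).
  by exists L, l; apply: kernel_reflect; rewrite hl; exact: kernel_iso st hK.
- move=> X Y f /mono_preserve/(half_mono_is_kernel hD)[z [g hg]].
  have [Z [s [t [ts st]]]] := equiv_esurj eqF z.
  have [h hh] := equiv_full eqF (t ∘ g).
  exists Z, h; apply: kernel_reflect; rewrite hh.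
  exact: (kernel_comp_iso (g := s)).
Qed.

End Equivalence.

Definition op_functor (C D : category) (F : functor C D) : functor (op C) (op D).
Proof.
refine (@Functor (op C) (op D) F (fun X Y f => @fmap C D F Y X f) _ _).
- by move=> X; exact: (fmap_id F).
- by move=> X Y Z g f; exact: (@fmap_comp C D F Z Y X f g).
Defined.

Lemma equivalence_op (C D : category) (F : functor C D) :
  is_equivalence F -> is_equivalence (op_functor F).
Proof.
move=> [full faith esurj]; split.
- by move=> X Y; exact: full.
- by move=> X Y; exact: faith.
- move=> Y; have [X [f [g [gf fg]]]] := esurj Y.
  by exists X, g, f.
Qed.

Lemma abelian_equiv (C D : category) (F : functor C D) :
  is_equivalence F -> is_abelian D -> is_abelian C.
Proof.
move=> eqF hD; apply: abelian_of_halves.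
  by apply: half_abelian_equiv eqF _; exact: abelian_half.
apply: half_abelian_equiv (equivalence_op eqF) _.
by apply: abelian_half; exact: abelian_op.
Qed.

(** * Equalizers and kernel pairs from normal monomorphisms *)

(** The two projections are indexed by [bool], so that a kernel pair is a family
    of morphisms and falls under the treatment of pointwise limits below. *)
Definition is_kernel_pair (C : category) (X Y : C) (f : hom X Y) (E : C)
    (p : bool -> hom E X) : Prop :=
  f ∘ p true = f ∘ p false /\
  forall (W : C) (g : bool -> hom W X), f ∘ g true = f ∘ g false ->
    exists! u : hom W E, forall b, p b ∘ u = g b.

Section KernelPairs.
Variable C : category.
Hypothesis hC : is_half_abelian C.

(** The two factors are spread over ['I_2] by a match on the underlying number,
    which computes on [ord0] and [ord_max]. *)
Lemma binary_product (X Y : C) : exists (P : C) (p : hom P X) (q : hom P Y),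
  forall (W : C) (f : hom W X) (g : hom W Y),
    exists! u : hom W P, p ∘ u = f /\ q ∘ u = g.
Proof.
pose Z (i : 'I_2) := if val i is 0%N then X else Y.
have [P [pr hP]] := half_products hC Z.
exists P, (pr ord0), (pr ord_max) => W f g.
have [u [hu uu]] := hP W (fun i =>
  match val i as n return hom W (if n is 0%N then X else Y) with
  | 0%N => f | _ => g end).
exists u; split=> [|v [hvf hvg]].
  by split; [exact: (hu ord0)|exact: (hu ord_max)].
apply: uu => -[[|[|i]] hi] //.
  by rewrite (_ : Ordinal hi = ord0) //; exact: val_inj.
by rewrite (_ : Ordinal hi = ord_max) //; exact: val_inj.
Qed.

(** The graphs [(1, f)] and [(1, g)] agree exactly on the equalizer of [f] and
    [g]. The first is a split monomorphism, hence the kernel of some [c], so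
    [f ∘ h = g ∘ h] holds exactly when [c] kills [(1, g) ∘ h]: the equalizer is
    the kernel of [c ∘ (1, g)]. *)
Lemma equalizer (X Y : C) (f g : hom X Y) : exists (E : C) (e : hom E X),
  f ∘ e = g ∘ e /\
  forall (W : C) (h : hom W X), f ∘ h = g ∘ h -> exists! u : hom W E, e ∘ u = h.
Proof.
have [P [p [q hP]]] := binary_product X Y.
have ext (W : C) (a b : hom W P) : p ∘ a = p ∘ b -> q ∘ a = q ∘ b -> a = b.
  move=> hp hq; have [u [_ uu]] := hP W (p ∘ b) (q ∘ b).
  by rewrite -(uu a) // -(uu b).
have [gf [[pf qf] _]] := hP X (idm X) f.
have [gg [[pg qg] _]] := hP X (idm X) g.
have mono_gf : is_mono gf.
  by move=> W a b /(congr1 (comp p)); rewrite !compA pf !comp_idl.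
have [Q [c [cf hc]]] := half_mono_is_kernel hC mono_gf.
have [E [e hE]] := half_kernels hC (c ∘ gg).
have eqP (W : C) (h : hom W X) :
    is_zero_morphism (c ∘ gg ∘ h) <-> f ∘ h = g ∘ h.
  rewrite -compA; split=> [/hc[u [hu _]]|fgh].
    have uh : u = h.
      by move/(congr1 (comp p)): hu; rewrite !compA pf pg !comp_idl.
    by move/(congr1 (comp q)): hu; rewrite !compA qf qg uh.
  rewrite (_ : gg ∘ h = gf ∘ h).
    by rewrite compA; exact: zero_morphism_compr.
  by apply: ext; rewrite !compA ?pf ?pg ?qf ?qg.
by exists E, e; case: hE => /eqP he hE; split=> // W h /eqP; exact: hE.
Qed.

Lemma kernel_pair (X Y : C) (f : hom X Y) :
  exists (E : C) (p : bool -> hom E X), is_kernel_pair f p.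
Proof.
have [P [p [q hP]]] := binary_product X X.
have [E [e [fe hE]]] := equalizer (f ∘ p) (f ∘ q).
exists E, (fun b => if b then p ∘ e else q ∘ e).
split=> [|W g fg]; first by rewrite !compA.
have [v [[pv qv] vv]] := hP W (g true) (g false).
have [|u [hu uu]] := hE W v; first by rewrite -!compA pv qv.
exists u; split=> [[]|w hw]; rewrite -?compA ?hu //.
apply: uu; symmetry; apply: vv.
by rewrite !compA; split; [exact: (hw true)|exact: (hw false)].
Qed.

End KernelPairs.

(** * Functor categories *)

Definition fun_cat (D A : category) : category.
Proof.
refine (@Category (functor D A) (@nat_trans D A) (@nat_id D A) (@nat_comp D A) _ _ _).
- by move=> F G s; apply: nat_trans_eq => d /=; rewrite comp_idl.
- by move=> F G s; apply: nat_trans_eq => d /=; rewrite comp_idr.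
- by move=> F G H K u t s; apply: nat_trans_eq => d /=; rewrite compA.
Defined.

Definition jointly_monic (C : category) (I : Type) (X : I -> C) (K : C)
    (p : forall i, hom K (X i)) : Prop :=
  forall (W : C) (g h : hom W K), (forall i, p i ∘ g = p i ∘ h) -> g = h.

Lemma product_jointly_monic (C : category) (I : Type) (X : I -> C) (K : C)
    (p : forall i, hom K (X i)) : is_product p -> jointly_monic p.
Proof.
move=> hp W g h e; have [u [_ uu]] := hp W (fun i => p i ∘ h).
by rewrite -(uu g) // -(uu h).
Qed.

(** Every pointwise limit used below is an instance of one construction: a
    family of objects [K d] with jointly monic projections to given functors is
    itself a functor as soon as the structure maps of these functors lift along
    the projections. The lifts are unique, so they compose, and a map into [K]
    which exists pointwise is automatically natural. *)
Section PointwiseCone.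
Variables (D A : category) (I : Type) (X : I -> functor D A).
Variables (K : D -> A) (p : forall d i, hom (K d) (X i d)).
Hypothesis p_monic : forall d, jointly_monic (p d).
Hypothesis p_stable : forall (d d' : D) (f : hom d d'),
  exists u : hom (K d) (K d'), forall i, p d' i ∘ u = fmap (X i) f ∘ p d i.

Definition cone_functor : functor D A.
Proof.
refine (@Functor D A K (fun d d' f => projT1 (cid (p_stable f))) _ _).
- move=> d; case: cid => u /= hu; apply: p_monic => i.
  by rewrite hu fmap_id comp_idl comp_idr.
- move=> a b c g f; case: cid => u /= hu; case: cid => v /= hv; case: cid => w /= hw.
  by apply: p_monic => i; rewrite hu compA hv -compA hw compA fmap_comp.
Defined.

Definition cone_proj (i : I) : nat_trans cone_functor (X i).
Proof.
refine (@NatTrans D A cone_functor (X i) (fun d => p d i) _).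
by move=> d d' f /=; case: cid => u /= ->.
Defined.

Lemma cone_universal (W : functor D A) (f : forall i, nat_trans W (X i)) :
  (forall d, exists u : hom (W d) (K d), forall i, p d i ∘ u = f i d) ->
  exists! u : nat_trans W cone_functor, forall i, nat_comp (cone_proj i) u = f i.
Proof.
move=> ex; pose u d := projT1 (cid (ex d)).
have hu d i : p d i ∘ u d = f i d by exact: projT2 (cid (ex d)) i.
have nat_u d d' (h : hom d d') : u d' ∘ fmap W h = fmap cone_functor h ∘ u d.
  apply: p_monic => i; rewrite !compA hu (naturality (f i)).
  by rewrite (naturality (cone_proj i) h) /= -compA hu.
exists (@NatTrans _ _ W cone_functor u nat_u); split=> [i|v hv].
  by apply: nat_trans_eq => d /=.
apply: nat_trans_eq => d /=; apply: p_monic => i.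
by rewrite hu -(hv i).
Qed.

End PointwiseCone.

Section FunctorCategory.
Variables (D A : category).
Hypothesis hA : is_half_abelian A.

Lemma fun_zero_object (Z : A) : is_zero_object Z ->
  exists F : functor D A, is_zero_object (F : fun_cat D A) /\ forall d, F d = Z.
Proof.
move=> hZ.
pose F := @Functor D A (fun=> Z) (fun _ _ _ => idm Z) (fun=> erefl)
  (fun _ _ _ _ _ => esym (comp_idl (idm Z))).
exists F; split=> // X; split.
  have to d : hom (X d) Z by have [/cid[f _] _] := hZ (X d).
  have nat_to d d' (h : hom d d') : to d' ∘ fmap X h = fmap F h ∘ to d.
    exact: hom_to_zero_eq.
  exists (@NatTrans _ _ X F to nat_to); split=> // t _; apply: nat_trans_eq => d.
  exact: hom_to_zero_eq.
have from d : hom Z (X d) by have [_ /cid[f _]] := hZ (X d).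
have nat_from d d' (h : hom d d') : from d' ∘ fmap F h = fmap X h ∘ from d.
  exact: hom_from_zero_eq.
exists (@NatTrans _ _ F X from nat_from); split=> // t _; apply: nat_trans_eq => d.
exact: hom_from_zero_eq.
Qed.

(** A zero object of the functor category is pointwise zero because it is
    isomorphic to a constant one; comparing with a constant zero functor handles
    both directions. *)
Lemma fun_zero_morphism (F G : functor D A) (f : nat_trans F G) :
  @is_zero_morphism (fun_cat D A) F G f <-> forall d, is_zero_morphism (f d).
Proof.
have [z hz] := half_zero_object hA; have [Z [hZ Zz]] := fun_zero_object hz.
have hZd d : is_zero_object (Z d) by rewrite Zz.
split=> [/(zero_morphism_factor hZ)[a [b ->]] d|hf].
  by exists (Z d); split=> //; exists (component a d), (component b d).
have [[a _] _] := hZ F; have [_ [b _]] := hZ G.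
exists Z; split=> //; exists a, b; apply: nat_trans_eq => d.
apply: zero_morphism_eq => //.
by exists (Z d); split=> //; exists (component a d), (component b d).
Qed.

Lemma fun_products (I : Type) (X : I -> functor D A) :
  (forall d, exists (P : A) (pr : forall i, hom P (X i d)), is_product pr) ->
  exists (P : fun_cat D A) (pr : forall i, hom P (X i : fun_cat D A)), is_product pr.
Proof.
move=> /dependent_choice2[P [pr hP]].
have monic d := product_jointly_monic (hP d).
have stable d d' (f : hom d d') : exists u : hom (P d) (P d'),
    forall i, pr d' i ∘ u = fmap (X i) f ∘ pr d i.
  by have [u [hu _]] := hP d' (P d) (fun i => fmap (X i) f ∘ pr d i); exists u.
exists (cone_functor monic stable), (cone_proj monic stable) => W f.
apply: cone_universal => d.
by have [u [hu _]] := hP d (W d) (fun i => f i d); exists u.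
Qed.

Lemma pointwise_kernels (F G : functor D A) (f : nat_trans F G) :
  exists (K : functor D A) (k : nat_trans K F), forall d, is_kernel (f d) (k d).
Proof.
have /dependent_choice2[K [k hK]] := fun d => half_kernels hA (f d).
pose p d (_ : unit) := k d.
have monic d : jointly_monic (p d).
  by move=> W g h /(_ tt); exact: (kernel_mono (hK d)).
have stable d d' (h : hom d d') : exists u : hom (K d) (K d'),
    forall i, p d' i ∘ u = fmap F h ∘ p d i.
  have [_ /(_ _ (fmap F h ∘ k d))[|u [hu _]]] := hK d'; last by exists u.
  rewrite compA naturality -compA; apply: zero_morphism_compl.
  by case: (hK d).
by exists (cone_functor monic stable), (cone_proj monic stable tt).
Qed.

Lemma pointwise_kernel_is_kernel (F G K : functor D A) (f : nat_trans F G)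
    (k : nat_trans K F) : (forall d, is_kernel (f d) (k d)) ->
  @is_kernel (fun_cat D A) F G f K k.
Proof.
move=> hK; split; first by apply/fun_zero_morphism => d; case: (hK d).
move=> W g /fun_zero_morphism fg.
have ex d : exists u : hom (W d) (K d), k d ∘ u = g d.
  by have [_ /(_ _ _ (fg d))[u [hu _]]] := hK d; exists u.
pose u d := projT1 (cid (ex d)).
have hu d : k d ∘ u d = g d by exact: projT2 (cid (ex d)).
have nat_u d d' (h : hom d d') : u d' ∘ fmap W h = fmap K h ∘ u d.
  apply: (kernel_mono (hK d')).
  by rewrite !compA hu !naturality -compA hu.
exists (@NatTrans _ _ W K u nat_u); split; first exact: nat_trans_eq.
move=> v hv; apply: nat_trans_eq => d /=.
by apply: (kernel_mono (hK d)); rewrite hu -hv.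
Qed.

(** The pointwise kernel pairs assemble into a functor with two projections to
    [F], equalized by [f]. They coincide since [f] is monic; so the two
    projections of every pointwise kernel pair coincide, which forces any two
    morphisms identified by a component of [f] to be equal. *)
Lemma mono_pointwise (F G : functor D A) (f : nat_trans F G) :
  @is_mono (fun_cat D A) F G f -> forall d, is_mono (f d).
Proof.
move=> mono_f.
have /dependent_choice2[E [p hE]] := fun d => kernel_pair hA (f d).
have monic d : jointly_monic (p d).
  move=> W g h e; have [fp /(_ _ (fun b => p d b ∘ h))[|u [_ uu]]] := hE d.
    by rewrite !compA fp.
  by rewrite -(uu g) // -(uu h).
have stable d d' (h : hom d d') : exists u : hom (E d) (E d'),
    forall b : bool, p d' b ∘ u = fmap F h ∘ p d b.
  have [_ /(_ _ (fun b => fmap F h ∘ p d b))[|u [hu _]]] := hE d'.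
    by rewrite !compA !naturality -!compA; case: (hE d) => ->.
  by exists u.
pose pi := @cone_proj D A bool (fun=> F) E p monic stable.
have pi_eq : pi true = pi false.
  by apply: mono_f; apply: nat_trans_eq => d /=; case: (hE d).
move=> d W g h fgh.
have [_ /(_ _ (fun b : bool => if b then g else h) fgh)[u [hu _]]] := hE d.
rewrite -(hu true) -(hu false); congr (_ ∘ _).
by move/(congr1 (fun t => component t d)): pi_eq.
Qed.

End FunctorCategory.

Definition unop_functor (D A : category) (F : functor (op D) (op A)) : functor D A.
Proof.
refine (@Functor D A F (fun X Y f => @fmap (op D) (op A) F Y X f) _ _).
- by move=> X; exact: (fmap_id F).
- by move=> X Y Z g f; exact: (@fmap_comp (op D) (op A) F Z Y X f g).
Defined.

Definition op_nat (D A : category) (F G : functor D A) (s : nat_trans F G) :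
  nat_trans (op_functor G) (op_functor F) :=
  @NatTrans (op D) (op A) (op_functor G) (op_functor F) s
    (fun X Y f => esym (naturality s f)).

Definition op_fun_cat (D A : category) :
  functor (op (fun_cat D A)) (fun_cat (op D) (op A)).
Proof.
refine (@Functor (op (fun_cat D A)) (fun_cat (op D) (op A))
  (@op_functor D A) (fun F G s => op_nat s) _ _).
- by move=> F; exact: nat_trans_eq.
- by move=> F G H t s; exact: nat_trans_eq.
Defined.

(** Functors and transformations on both sides are given by the same data; only
    the proofs of the functor laws can differ, so identity components are enough
    to show essential surjectivity. *)
Lemma op_fun_cat_equivalence (D A : category) : is_equivalence (op_fun_cat D A).
Proof.
split.
- move=> F G s.
  exists (@NatTrans D A G F (component s)
    (fun X Y f => esym (@naturality _ _ _ _ s Y X f))).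
  exact: nat_trans_eq.
- move=> F G s t e; apply: nat_trans_eq => d.
  by move/(congr1 (fun r : nat_trans (op_functor F) (op_functor G) => component r d)): e.
- move=> F; exists (unop_functor F).
  have nat_id1 (X Y : op D) (f : hom X Y) :
      @idm (op A) (F Y) ∘ fmap F f = fmap F f ∘ idm (F X).
    by rewrite comp_idl comp_idr.
  exists (@NatTrans (op D) (op A) (op_functor (unop_functor F)) F _ nat_id1).
  exists (@NatTrans (op D) (op A) F (op_functor (unop_functor F)) _ nat_id1).
  by split; apply: nat_trans_eq => d /=; rewrite comp_idl.
Qed.

(** A pointwise monic transformation will be exhibited as the kernel of the
    transformation obtained here. Cokernels are kernels in the opposite category,
    so it comes from pointwise kernels of functors between the opposites. *)
Lemma pointwise_cokernels (D A : category) : is_abelian A ->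
  forall (F G : functor D A) (f : nat_trans F G),
  exists (Q : functor D A) (q : nat_trans G Q), forall d, is_cokernel (f d) (q d).
Proof.
move=> /abelian_op/abelian_half hA F G f.
have [Q [q hq]] := pointwise_kernels hA (op_nat f).
exists (unop_functor Q).
exists (@NatTrans D A G (unop_functor Q) (component q)
  (fun X Y h => esym (@naturality _ _ _ _ q Y X h))) => d.
by rewrite -kernel_op; exact: hq.
Qed.

Lemma kernel_of_cokernel (C : category) (X Y Q : C) (f : hom X Y) (q : hom Y Q) :
  (exists (Z : C) (g : hom Y Z), is_kernel g f) -> is_cokernel f q -> is_kernel q f.
Proof.
move=> [Z [g [gf hf]]] [qf hq]; split=> // W h qh; apply: hf.
by have [u [<- _]] := hq _ g gf; rewrite -compA; exact: zero_morphism_compl.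
Qed.

Lemma fun_half_abelian (D A : category) :
  is_abelian A -> is_half_abelian (fun_cat D A).
Proof.
move=> abA; have hA := abelian_half abA; split.
- have [z /(@fun_zero_object D)[Z [hZ _]]] := has_zero_object abA.
  by exists Z.
- move=> n X; apply: fun_products => d; exact: has_finite_products abA _ _.
- move=> F G f; have [K [k hK]] := pointwise_kernels hA f.
  by exists K, k; exact: pointwise_kernel_is_kernel.
- move=> F G f mono_f; have [Q [q hq]] := pointwise_cokernels abA f.
  exists Q, q; apply: pointwise_kernel_is_kernel => // d.
  apply: kernel_of_cokernel (hq d); apply: (mono_is_kernel abA).
  exact: mono_pointwise mono_f d.
Qed.

Lemma fun_abelian (D A : category) : is_abelian A -> is_abelian (fun_cat D A).
Proof.
move=> hA; apply: abelian_of_halves; first exact: fun_half_abelian.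
apply: half_abelian_equiv (op_fun_cat_equivalence D A) _.
by apply: fun_half_abelian; exact: abelian_op.
Qed.

(** * Interleavings as diagrams *)

(** The real line and the index category of interleavings have at most one
    morphism between two objects; any two composites of structure maps with the
    same ends are then equal in a diagram. *)
Definition is_thin (C : category) : Prop :=
  forall (X Y : C) (f g : hom X Y), f = g.

Section Thin.
Variables (C D : category) (F : functor C D).
Hypothesis thinC : is_thin C.

Lemma thin_fmap (X Y : C) (f g : hom X Y) : fmap F f = fmap F g.
Proof. by rewrite (thinC f g). Qed.

Lemma thin_fmap_id (X : C) (f : hom X X) : fmap F f = idm (F X).
Proof. by rewrite -fmap_id (thinC f (idm X)). Qed.

Lemma thin_fmap_comp (X Y Z : C) (g : hom Y Z) (f : hom X Y) (h : hom X Z) :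
  fmap F g ∘ fmap F f = fmap F h.
Proof. by rewrite -fmap_comp (thinC (g ∘ f) h). Qed.

End Thin.

Section Shape.
Variables (R : realType) (e : R) (he : 0 <= e).

(** The first component names the copy of the real line, [false] for the functor
    [F] and [true] for [G]; changing copy costs [e]. *)
Definition shape_le (x y : bool * R) : bool :=
  (if x.1 (+) y.1 then x.2 + e else x.2) <= y.2.

Lemma shape_le_refl x : shape_le x x.
Proof. by rewrite /shape_le addbb. Qed.

Lemma shape_le_trans x y z : shape_le y z -> shape_le x y -> shape_le x z.
Proof.
case: x y z => [[] a] [[] b] [[] c]; rewrite /shape_le /= => bc ab.
- exact: le_trans bc.
- by apply: le_trans bc; rewrite lerD2r.
- exact: le_trans (le_trans (le_shift2 he a) (lerD ab (lexx e))) bc.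
- exact: le_trans bc.
- exact: le_trans bc.
- exact: le_trans (le_trans (le_shift2 he a) (lerD ab (lexx e))) bc.
- by apply: le_trans bc; rewrite lerD2r.
- exact: le_trans bc.
Qed.

Definition shape : category.
Proof.
refine (@Category (bool * R) shape_le shape_le_refl
  (fun x y z => @shape_le_trans x y z) _ _ _);
by move=> *; exact: bool_irrelevance.
Defined.

Variable A : category.

Lemma real_thin : is_thin (real_cat R).
Proof. by move=> a b; exact: bool_irrelevance. Qed.

Lemma shape_thin : is_thin shape.
Proof. by move=> x y; exact: bool_irrelevance. Qed.

Section Diagram.
Variable I : interleaving he A.

Definition diagram_obj (x : shape) : A := if x.1 then ilG I x.2 else ilF I x.2.

Definition diagram_map (x y : shape) : hom x y -> hom (diagram_obj x) (diagram_obj y) :=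
  match x, y with
  | (false, a), (false, b) => fun h => fmap (ilF I) (h : @hom (real_cat R) a b)
  | (false, a), (true, b) =>
      fun h => fmap (ilG I) (h : @hom (real_cat R) (a + e) b) ∘ ilphi I a
  | (true, a), (false, b) =>
      fun h => fmap (ilF I) (h : @hom (real_cat R) (a + e) b) ∘ ilpsi I a
  | (true, a), (true, b) => fun h => fmap (ilG I) (h : @hom (real_cat R) a b)
  end.

Lemma diagram_map_id x : diagram_map (idm x) = idm (diagram_obj x).
Proof. by case: x => -[] a; apply: thin_fmap_id real_thin _ _. Qed.

(** Within one copy this is functoriality, for one change of copy it is
    functoriality or naturality, and for a change of copy and back it is an
    interleaving identity. *)
Lemma diagram_map_comp (x y z : shape) (g : hom y z) (f : hom x y) :
  diagram_map (g ∘ f) = diagram_map g ∘ diagram_map f.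
Proof.
case: x y z g f => [[] a] [[] b] [[] c] g f /=.
- by symmetry; apply: thin_fmap_comp real_thin _ _ _ _ _ _.
- rewrite -compA (naturality (ilpsi I) (f : @hom (real_cat R) a b)) compA.
  congr (_ ∘ _); symmetry; apply: thin_fmap_comp real_thin _ _ _ _ _ _.
- rewrite -compA (compA (ilphi I b)).
  rewrite (naturality (ilphi I) (f : @hom (real_cat R) (a + e) b)) -compA il_phipsi.
  rewrite /= -fmap_comp; symmetry; apply: thin_fmap_comp real_thin _ _ _ _ _ _.
- by rewrite compA; congr (_ ∘ _); symmetry; apply: thin_fmap_comp real_thin _ _ _ _ _ _.
- by rewrite compA; congr (_ ∘ _); symmetry; apply: thin_fmap_comp real_thin _ _ _ _ _ _.
- rewrite -compA (compA (ilpsi I b)).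
  rewrite (naturality (ilpsi I) (f : @hom (real_cat R) (a + e) b)) -compA il_psiphi.
  rewrite /= -fmap_comp; symmetry; apply: thin_fmap_comp real_thin _ _ _ _ _ _.
- rewrite -compA (naturality (ilphi I) (f : @hom (real_cat R) a b)) compA.
  congr (_ ∘ _); symmetry; apply: thin_fmap_comp real_thin _ _ _ _ _ _.
- by symmetry; apply: thin_fmap_comp real_thin _ _ _ _ _ _.
Qed.

Definition diagram : functor shape A :=
  Functor diagram_map_id diagram_map_comp.
End Diagram.

Definition diagram_nat (I J : interleaving he A) (s : interleaving_hom I J) :
  nat_trans (diagram I) (diagram J).
Proof.
refine (@NatTrans shape A (diagram I) (diagram J)
  (fun x => match x as y return hom (diagram I y) (diagram J y) with
     | (false, a) => ilalpha s a
     | (true, a) => ilbeta s a end) _).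
have hphi a := congr1 (fun t => component t a) (ilhom_phi s).
have hpsi a := congr1 (fun t => component t a) (ilhom_psi s).
move=> [[] a] [[] b] f /=.
- exact: naturality.
- by rewrite compA naturality -compA [X in _ ∘ X]hpsi compA.
- by rewrite compA naturality -compA [X in _ ∘ X]hphi compA.
- exact: naturality.
Defined.

Definition diagram_functor : functor (Int he A) (fun_cat shape A).
Proof.
refine (@Functor (Int he A) (fun_cat shape A) diagram diagram_nat _ _).
- by move=> I; apply: nat_trans_eq => -[[] a].
- by move=> I J K t s; apply: nat_trans_eq => -[[] a].
Defined.

Lemma diagram_functor_faithful (I J : interleaving he A)
    (s t : interleaving_hom I J) : diagram_nat s = diagram_nat t -> s = t.
Proof.
move=> st; apply: interleaving_hom_eq => a.
  by move/(congr1 (fun r : nat_trans (diagram I) (diagram J) => r (false, a))): st.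
by move/(congr1 (fun r : nat_trans (diagram I) (diagram J) => r (true, a))): st.
Qed.

Lemma cross_le (i : bool) (a : R) : shape_le (i, a) (~~ i, a + e).
Proof. by rewrite /shape_le addbN addbb. Qed.

Definition cross (i : bool) (a : R) : @hom shape (i, a) (~~ i, a + e) := cross_le i a.

(** Naturality along the morphisms from [(i, a)] to [(~~ i, a + e)] is the
    compatibility with [phi] and [psi] that a morphism of interleavings
    requires. *)
Lemma diagram_functor_full (I J : interleaving he A)
    (t : nat_trans (diagram I) (diagram J)) :
  exists s : interleaving_hom I J, diagram_nat s = t.
Proof.
pose al := @NatTrans (real_cat R) A (ilF I) (ilF J) (fun a => t (false, a))
  (fun a b h => @naturality _ _ _ _ t (false, a) (false, b) h).
pose be := @NatTrans (real_cat R) A (ilG I) (ilG J) (fun a => t (true, a))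
  (fun a b h => @naturality _ _ _ _ t (true, a) (true, b) h).
have hphi : nat_comp (whisker be (shift e)) (ilphi I) = nat_comp (ilphi J) al.
  apply: nat_trans_eq => a; have := naturality t (cross false a).
  by rewrite /= !(thin_fmap_id _ real_thin) !comp_idl.
have hpsi : nat_comp (whisker al (shift e)) (ilpsi I) = nat_comp (ilpsi J) be.
  apply: nat_trans_eq => a; have := naturality t (cross true a).
  by rewrite /= !(thin_fmap_id _ real_thin) !comp_idl.
by exists (InterleavingHom hphi hpsi); apply: nat_trans_eq => -[[] a].
Qed.

Lemma side_le (i : bool) (a b : R) : a <= b -> shape_le (i, a) (i, b).
Proof. by rewrite /shape_le addbb. Qed.

Definition side (i : bool) : functor (real_cat R) shape.
Proof.
refine (@Functor (real_cat R) shape (fun a => (i, a))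
  (fun a b h => side_le i h)
  _ _); by move=> *; exact: shape_thin.
Defined.

Definition cross_nat (H : functor shape A) (i : bool) :
  nat_trans (functor_comp H (side i))
    (functor_comp (functor_comp H (side (~~ i))) (shift e)).
Proof.
refine (@NatTrans (real_cat R) A (functor_comp H (side i))
  (functor_comp (functor_comp H (side (~~ i))) (shift e))
  (fun a => fmap H (cross i a)) _).
by move=> a b h /=; rewrite -!fmap_comp; congr fmap; exact: shape_thin.
Defined.

(** The composites in both interleaving identities are images of morphisms
    between the same two points, so they hold by thinness. *)
Definition diagram_interleaving (H : functor shape A) : interleaving he A.
Proof.
refine (@Interleaving R e he A (functor_comp H (side false))
  (functor_comp H (side true)) (cross_nat H false) (cross_nat H true) _ _) => a /=.
- exact: (thin_fmap_comp _ shape_thin).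
- exact: (thin_fmap_comp _ shape_thin).
Defined.

(** The diagram of [diagram_interleaving H] has the values of [H] on objects,
    but only after a case analysis on the copy; the isomorphism is the identity
    written through this case analysis. *)
Lemma diagram_functor_esurj (H : functor shape A) :
  exists (s : nat_trans (diagram (diagram_interleaving H)) H)
         (t : nat_trans H (diagram (diagram_interleaving H))),
  (forall x, t x ∘ s x = idm _) /\ (forall x, s x ∘ t x = idm (H x)).
Proof.
set G := diagram _.
pose s x : hom (G x) (H x) :=
  match x with (false, a) => idm (H (false, a)) | (true, a) => idm (H (true, a)) end.
pose t x : hom (H x) (G x) :=
  match x with (false, a) => idm (H (false, a)) | (true, a) => idm (H (true, a)) end.
have nat_s x y (f : hom x y) : s y ∘ fmap G f = fmap H f ∘ s x.
  by case: x y f => [[] a] [[] b] f /=; rewrite comp_idl comp_idr;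
    [ exact: (thin_fmap _ shape_thin) | exact: (thin_fmap_comp _ shape_thin)
    | exact: (thin_fmap_comp _ shape_thin) | exact: (thin_fmap _ shape_thin)].
have nat_t x y (f : hom x y) : t y ∘ fmap H f = fmap G f ∘ t x.
  by case: x y f => [[] a] [[] b] f /=; rewrite comp_idl comp_idr; symmetry;
    [ exact: (thin_fmap _ shape_thin) | exact: (thin_fmap_comp _ shape_thin)
    | exact: (thin_fmap_comp _ shape_thin) | exact: (thin_fmap _ shape_thin)].
exists (@NatTrans _ _ G H s nat_s), (@NatTrans _ _ H G t nat_t).
by split=> -[[] a] /=; rewrite comp_idl.
Qed.

Lemma diagram_functor_equivalence : is_equivalence diagram_functor.
Proof.
split.
- exact: diagram_functor_full.
- exact: diagram_functor_faithful.
- move=> H; exists (diagram_interleaving H).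
  have [s [t [ts st]]] := diagram_functor_esurj H.
  by exists s, t; split; exact: nat_trans_eq.
Qed.

End Shape.

Theorem theorem7p10 (R : realType) (A : category) (hA : is_abelian A)
  (e : R) (he : 0 <= e) : is_abelian (Int he A).
Proof.
apply: abelian_equiv (diagram_functor_equivalence he A) _.
exact: fun_abelian.
Qed.
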